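(* For every algebra $\mathbf{A}$ (of an arbitrary purely algebraic signature), the following are equivalent. 1. $\mathbf{A}$ satisfies a nontrivial idempotent equational condition. 2. $\mathbf{A}$ has a $6$-ary idempotent term $t$ such that $\mathbf{A}$ satisfies the equations \[ t(x,y,y,y,x,x) \approx t(y,x,y,x,y,x) \approx t(y,y,x,x,x,y). \]
   Context: A signature is a set of operation symbols with associated finite arities. An algebra $\mathbf{A}$ of signature $\Sigma$ is a set $A$ together with an operation $f^{\mathbf{A}}:A^{\mathrm{Ar} f}\to A$ for each $f\in\Sigma$, where $\mathrm{Ar} f$ is the arity of $f$. A term of $\mathbf{A}$ is a term in the signature $\Sigma$. An equation is a pair of terms, written $s\approx t$; $\mathbf{A}$ satisfies $s\approx t$ if both terms evaluate to the same element under every evaluation of the variables in $A$. A term $t$ is idempotent (in $\mathbf A$) if $\mathbf{A}$ satisfies $t(x,x,\dots,x)\approx x$. An equational condition $\mathcal{S}$ is a system of equations in some signature $\Delta$. An algebra $\mathbf{A}$ of a signature $\Sigma$ satisfies the equational condition $\mathcal{S}$ if one can replace each operation symbol in $\Delta$ by a term in the signature $\Sigma$ (of the same arity) so that all equations of $\mathcal{S}$ become satisfied in $\mathbf{A}$. An equational condition is trivial if it is satisfied in every algebra (equivalently, in an algebra in the empty signature with at least two elements, where all terms are variables), and nontrivial otherwise. An equational condition is idempotent if for each operation symbol $f$ appearing in it, the equation $f(x,x,\dots,x)\approx x$ is a consequence of its equations (i.e., it holds in every algebra of signature $\Delta$ satisfying all the equations of the condition). *)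

(* Defs.v *)
From mathcomp Require Import all_boot.

Set Implicit Arguments.
Unset Strict Implicit.
Unset Printing Implicit Defensive.

Record signature : Type := Signature {
  symbol : Type;
  arity : symbol -> nat
}.

(* The carrier may be empty, and [n]-tuples are functions on ['I_n]. *)
Record algebra (Sigma : signature) : Type := Algebra {
  carrier :> Type;
  interp : forall f : symbol Sigma, ('I_(arity f) -> carrier) -> carrier
}.

(* [term Sigma 'I_n] is the type of [n]-ary terms. *)
Inductive term (Sigma : signature) (X : Type) : Type :=
| Var (x : X)
| App (f : symbol Sigma) (args : 'I_(arity f) -> term Sigma X).

Arguments Var {Sigma X} x.
Arguments App {Sigma X} f args.

Fixpoint eval (Sigma : signature) (A : algebra Sigma) (X : Type) (v : X -> A)
    (t : term Sigma X) : A :=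
  match t with
  | Var x => v x
  | App f args => interp (fun i => eval v (args i))
  end.

Fixpoint subst (Sigma : signature) (X Y : Type) (s : X -> term Sigma Y)
    (t : term Sigma X) : term Sigma Y :=
  match t with
  | Var x => s x
  | App f args => App f (fun i => subst s (args i))
  end.

(* [plug t u] is the term written t(u_1, ..., u_n). *)
Definition plug (Sigma : signature) (n : nat) (X : Type)
    (t : term Sigma 'I_n) (u : n.-tuple (term Sigma X)) : term Sigma X :=
  subst (tnth u) t.

(* Equations are written in the countably many variables [Var 0, Var 1, ...];
   the pair [(s, t)] stands for s ≈ t. *)
Definition equation (Sigma : signature) : Type :=
  (term Sigma nat * term Sigma nat)%type.

Definition satisfies_eq (Sigma : signature) (A : algebra Sigma)
    (e : equation Sigma) : Prop :=
  forall v : nat -> A, eval v e.1 = eval v e.2.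

Definition idempotent_term (Sigma : signature) (A : algebra Sigma) (n : nat)
    (t : term Sigma 'I_n) : Prop :=
  satisfies_eq A (plug t [tuple of nseq n (Var 0)], Var 0).

(* Neither the signature nor the system of equations need be finite. *)
Record eq_condition : Type := EqCondition {
  cond_sig : signature;
  cond_eqs : equation cond_sig -> Prop
}.

(* Replace every operation symbol [f] of [Delta] by the term [tau f]. *)
Fixpoint translate (Delta Sigma : signature)
    (tau : forall f : symbol Delta, term Sigma 'I_(arity f)) (X : Type)
    (t : term Delta X) : term Sigma X :=
  match t with
  | Var x => Var x
  | App f args => subst (fun i => translate tau (args i)) (tau f)
  end.

Definition satisfies_cond (Sigma : signature) (A : algebra Sigma)
    (S : eq_condition) : Prop :=
  exists tau : forall f : symbol (cond_sig S), term Sigma 'I_(arity f),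
    forall s t : term (cond_sig S) nat,
      cond_eqs (s, t) -> satisfies_eq A (translate tau s, translate tau t).

Definition trivial_cond (S : eq_condition) : Prop :=
  forall (Sigma : signature) (A : algebra Sigma), satisfies_cond A S.

Definition consequence (S : eq_condition) (e : equation (cond_sig S)) : Prop :=
  forall B : algebra (cond_sig S),
    (forall e', cond_eqs e' -> satisfies_eq B e') -> satisfies_eq B e.

(* All symbols of the signature of [S] count as appearing in [S].  Exempting
   the symbols that occur in no equation would make the condition consisting of
   one constant and no equation both idempotent and nontrivial. *)
Definition idempotent_cond (S : eq_condition) : Prop :=
  forall f : symbol (cond_sig S), consequence (App f (fun=> Var 0), Var 0).

(* Main.v *)
(* Let B be A with the idempotent operations given by the condition.  By
   compactness finitely many equations of the condition already fail in every
   algebra of projections, so a long self-composition s of a star product of the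
   operations satisfies finitely many identities s(a) ≈ s(b) in two variables
   such that no column is constant in all of them.  Columns of s * s * s may be
   regarded as three columns of s chosen in turn; letting the two sides of one
   identity look at different rounds lowers the number of identities by one as
   long as it is at least three.

   From two identities s(a1) ≈ s(b1) and s(a2) ≈ s(b2) one gets a constant triple
   in the ternary relation [nae] generated by the nonconstant triples over {x, y},
   which is the required 6-ary term.  Write bar for the exchange of x and y; then
   (u, bar u, w) is in [nae] for all u and w.  Idempotence lets the coordinates
   of a triple be expanded at different moments, and this yields first u, v with
   (u, u, v) and (u, u, bar v) in [nae], then such u, v for which also (v, v, u)
   and (v, v, bar u) are in [nae], and then a constant triple. *)

Require Import Defs.
From Stdlib Require List.
From mathcomp Require Import all_boot.
From mathcomp Require Import boolp classical_sets filter.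

Set Implicit Arguments.
Unset Strict Implicit.
Unset Printing Implicit Defensive.

(** * Evaluation and idempotence *)

Lemma eq_eval (D : signature) (B : algebra D) (X : Type) (v w : X -> B)
  (t : term D X) : v =1 w -> eval v t = eval w t.
Proof. by move=> /funext ->. Qed.

Lemma eval_subst (D : signature) (B : algebra D) (X Y : Type) (v : Y -> B)
    (h : X -> term D Y) (t : term D X) :
  eval v (subst h t) = eval (fun x => eval v (h x)) t.
Proof.
by elim: t => //= f args IH; congr (interp _); apply/funext => i; exact: IH.
Qed.

Definition idempotent (D : signature) (B : algebra D) : Prop :=
  forall (f : symbol D) (b : B), interp (f := f) (fun=> b) = b.

Lemma eval_const (D : signature) (B : algebra D) (X : Type) (b : B)
  (t : term D X) : idempotent B -> eval (fun=> b) t = b.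
Proof.
move=> idemB; elim: t => //= f args IH.
rewrite -[RHS](idemB f); congr (interp _); exact: funext.
Qed.

(** * Binary terms and the relation of nonconstant triples *)

Section BinaryTerms.
Variables (D : signature) (B : algebra D).
Hypothesis idemB : idempotent B.

Local Notation E := (term D bool).

Definition eqv (u v : E) : Prop := forall nu : bool -> B, eval nu u = eval nu v.
Local Notation "u =~ v" := (eqv u v) (at level 70).

Lemma eqv_refl u : u =~ u. Proof. by []. Qed.
Hint Resolve eqv_refl : core.

Lemma eqv_sym u v : u =~ v -> v =~ u.
Proof. by move=> uv nu. Qed.

Definition bar (u : E) : E := subst (fun b => Var (~~ b)) u.
Definition lit (b : bool) (u : E) : E := if b then u else bar u.

Lemma eval_bar (nu : bool -> B) u : eval nu (bar u) = eval (fun b => nu (~~ b)) u.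
Proof. exact: eval_subst. Qed.

Lemma barK u : bar (bar u) =~ u.
Proof.
move=> nu; rewrite !eval_bar.
by apply: eq_eval => b; rewrite negbK.
Qed.

Lemma bar_eqv u v : u =~ v -> bar u =~ bar v.
Proof. by move=> uv nu; rewrite !eval_bar uv. Qed.

Lemma subst_const (X : Type) u (t : term D X) : u =~ subst (fun=> u) t.
Proof. by move=> nu; rewrite eval_subst eval_const. Qed.

(* The subalgebra of E^3, up to [eqv], generated by the nonconstant triples. *)
Inductive nae : E -> E -> E -> Prop :=
| nae_var i j k of ~~ ((i == j) && (j == k)) : nae (Var i) (Var j) (Var k)
| nae_app f us vs ws of (forall i : 'I_(arity f), nae (us i) (vs i) (ws i)) :
    nae (App f us) (App f vs) (App f ws)
| nae_eqv u v w u' v' w' of nae u v w & u =~ u' & v =~ v' & w =~ w' :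
    nae u' v' w'.

Lemma nae_swap12 u v w : nae u v w -> nae v u w.
Proof.
elim=> {u v w} [i j k|f us vs ws _ IH|u v w u' v' w' _ H uu' vv' ww'].
- by move=> ijk; apply: nae_var; move: ijk; case: i j k => [] [] [].
- exact: nae_app.
- exact: nae_eqv H vv' uu' ww'.
Qed.

Lemma nae_swap23 u v w : nae u v w -> nae u w v.
Proof.
elim=> {u v w} [i j k|f us vs ws _ IH|u v w u' v' w' _ H uu' vv' ww'].
- by move=> ijk; apply: nae_var; move: ijk; case: i j k => [] [] [].
- exact: nae_app.
- exact: nae_eqv H uu' ww' vv'.
Qed.

Lemma nae_bar u v w : nae u v w -> nae (bar u) (bar v) (bar w).
Proof.
elim=> {u v w} [i j k|f us vs ws _ IH|u v w u' v' w' _ H uu' vv' ww'].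
- by move=> ijk; apply: nae_var; move: ijk; case: i j k => [] [] [].
- exact: nae_app.
- exact: nae_eqv H (bar_eqv uu') (bar_eqv vv') (bar_eqv ww').
Qed.

Lemma nae_subst (X : Type) (t : term D X) (h1 h2 h3 : X -> E) :
  (forall x, nae (h1 x) (h2 x) (h3 x)) ->
  nae (subst h1 t) (subst h2 t) (subst h3 t).
Proof. by move=> H; elim: t => //= f args IH; apply: nae_app. Qed.

(** By idempotence the first two entries can stay fixed while [w] is decomposed, and [w] while [u]
    is; at the leaves the first two entries differ. *)
Lemma nae_compl u w : nae u (bar u) w.
Proof.
have base b : forall w, nae (Var b) (bar (Var b)) w.
  elim=> [c|f ws IH]; first by apply: nae_var; case: b c => [] [].
  have := nae_app IH => /nae_eqv; apply=> //; apply: eqv_sym => nu /=;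
    by rewrite idemB.
elim: u w => [b|f us IH] w; first exact: base.
have H : nae (App f us) (bar (App f us)) (App f (fun=> w)).
  by apply: nae_app => i; exact: IH.
by apply: nae_eqv H _ _ _ => // nu /=; rewrite idemB.
Qed.

Lemma nae_lit_neq b c u w : b != c -> nae (lit b u) (lit c u) w.
Proof.
case: b c => [] [] //= _; first exact: nae_compl.
exact/nae_swap12/nae_compl.
Qed.

Definition dominates (u v : E) : Prop := nae u u v /\ nae u u (bar v).

Lemma dominates_lit i j k u v :
  dominates u v -> nae (lit i u) (lit j u) (lit k v).
Proof.
move=> [uv uv']; case: (eqVneq i j) => [<-|]; last exact: nae_lit_neq.
have uvk : forall k, nae u u (lit k v) by case.
case: i => //=; have := nae_bar (uvk (~~ k)) => /nae_eqv; apply=> //.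
by case: k => //=; exact: barK.
Qed.

Lemma dominates_substl (X : Type) (t : term D X) (h : X -> bool) u v :
  dominates u v -> dominates (subst (fun x => lit (h x) u) t) v.
Proof.
move=> uv; split.
  apply: nae_eqv (eqv_refl _) (eqv_refl _) (eqv_sym (subst_const v t)).
  by apply: nae_subst => x; exact: (dominates_lit _ _ true).
apply: nae_eqv (eqv_refl _) (eqv_refl _) (eqv_sym (subst_const (bar v) t)).
by apply: nae_subst => x; exact: (dominates_lit _ _ false).
Qed.

(** * From two identities to a constant triple *)

Section DoubleLoop.
Variables (C : Type) (s : term D C) (a1 b1 a2 b2 : C -> bool).

(* [B] satisfies s(a) ≈ s(b), where a and b list the variables substituted into
   [s], true and false standing for x and y. *)
Definition bool_equation (a b : C -> bool) : Prop :=
  forall nu : bool -> B, eval (nu \o a) s = eval (nu \o b) s.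

Hypothesis E1 : bool_equation a1 b1.
Hypothesis E2 : bool_equation a2 b2.
Hypothesis cover : forall c, (a1 c != b1 c) || (a2 c != b2 c).

Local Notation S h := (subst h s).

Definition mix (a : C -> bool) (u : E) : E := S (fun c => lit (a c) u).

Lemma mix_eqv a b u : bool_equation a b -> mix a u =~ mix b u.
Proof.
move=> eab nu; rewrite /mix !eval_subst.
exact: (eab (fun i => eval nu (lit i u))).
Qed.

(** Written as the two sides of the identity, the two copies are complementary in every column where
    the sides differ; only the other columns need an argument. *)
Lemma nae_mix a b u (w : C -> E) : bool_equation a b ->
    (forall c, a c = b c -> nae (lit (a c) u) (lit (a c) u) (w c)) ->
  nae (mix a u) (mix a u) (S w).
Proof.
move=> eab H.
apply: nae_eqv (eqv_refl _) (eqv_sym (mix_eqv u eab)) (eqv_refl _).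
apply: nae_subst => c; case: (eqVneq (a c) (b c)) => [e|]; last exact: nae_lit_neq.
by rewrite -e; exact: H.
Qed.

Local Notation A1 c := (a1 c == b1 c).
Local Notation A2 c := (a2 c == b2 c).
Local Notation p := (mix a1).
Local Notation q := (mix a2).

Lemma eq1_neq2 c : A1 c -> A2 c = false.
Proof. by move=> h; move: (cover c); rewrite h /= => /negbTE. Qed.

Lemma bar_subst (h : C -> E) : bar (S h) =~ S (fun c => bar (h c)).
Proof.
move=> nu; rewrite eval_bar !eval_subst; apply: eq_eval => c.
by rewrite eval_bar.
Qed.

(** Two triples sharing a witness: [quad u u u u] says that [u] dominates some [e]. *)
Definition quad (u v w z : E) : Prop := exists e, nae u v e /\ nae w z (bar e).

Lemma quad_litl i j u w z : i != j -> quad (lit i u) (lit j u) w z.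
Proof.
by move=> ij; exists w; split; [exact: nae_lit_neq|exact/nae_swap23/nae_compl].
Qed.

Lemma quad_litr i j u w z : i != j -> quad w z (lit i u) (lit j u).
Proof.
move=> ij; exists (bar w); split; last exact: nae_lit_neq.
exact/nae_swap23/nae_compl.
Qed.

Lemma quad_subst (h1 h2 h3 h4 : C -> E) :
    (forall c, quad (h1 c) (h2 c) (h3 c) (h4 c)) ->
  quad (S h1) (S h2) (S h3) (S h4).
Proof.
move=> /choice[e He]; exists (S e); split.
  by apply: nae_subst => c; case: (He c).
apply: nae_eqv (eqv_refl _) (eqv_refl _) (eqv_sym (bar_subst e)).
by apply: nae_subst => c; case: (He c).
Qed.

Lemma quad_eqv u v w z u' v' w' z' : quad u v w z ->
  u =~ u' -> v =~ v' -> w =~ w' -> z =~ z' -> quad u' v' w' z'.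
Proof.
move=> [e [H1 H2]] uu vv ww zz; exists e.
by split; [exact: nae_eqv H1 _ _ _|exact: nae_eqv H2 _ _ _].
Qed.

Lemma eqv_subst (h h' : C -> E) : (forall c, h c =~ h' c) -> S h =~ S h'.
Proof. by move=> hh nu; rewrite !eval_subst; apply: eq_eval => c; exact: hh. Qed.

Lemma lit_mix i a u : lit i (mix a u) =~ mix a (lit i u).
Proof.
case: i => //= nu; rewrite bar_subst; apply: eqv_subst => c.
by case: (a c).
Qed.

(** In each column one of the two pairs is complementary and accepts any third entry, so [e] can be
    chosen to suit the other pair. *)
Lemma quad_mix u v : quad (p u) (p u) (q v) (q v).
Proof.
have H c : quad (lit (a1 c) u) (lit (b1 c) u) (lit (a2 c) v) (lit (b2 c) v).
  by have /orP[h|h] := cover c; [exact: quad_litl|exact: quad_litr].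
by apply: quad_eqv (quad_subst H) _ _ _ _ => //; exact/eqv_sym/mix_eqv.
Qed.

Lemma quad_sym u v w z : quad u v w z -> quad w z u v.
Proof.
move=> [e [H1 H2]]; exists (bar e); split=> //.
exact: nae_eqv H1 _ _ (eqv_sym (barK e)).
Qed.

(* The two copies of [M] on the left expand its outermost layer one step before
   the two copies on the right do. *)
Lemma dominating_pair : exists u v, dominates u v.
Proof.
pose x := @Var D bool true.
pose M := S (fun c => if A1 c then q (q x) else p (p x)).
suff [e [H1 H2]] : quad M M M M by exists M, e.
(* The left copies become the two sides of the first identity. Where these agree, [M] shows
   [q (q x)] and [quad_mix] applies. *)
have Hp : quad (p (p x)) (p (p x)) M M.
  have H d : quad (lit (a1 d) (p x)) (lit (b1 d) (p x))
     (if A1 d then q (q x) else p (p x)) (if A1 d then q (q x) else p (p x)).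
    case: (boolP (A1 d)) => [/eqP <-|]; last exact: quad_litl.
    apply: quad_eqv (quad_mix (lit (a1 d) x) (q x)) _ _ _ _ => //;
      exact/eqv_sym/lit_mix.
  by apply: quad_eqv (quad_subst H) _ _ _ _ => //; exact/eqv_sym/mix_eqv.
have Hq : quad (q (q x)) (q (q x)) M M.
  have H d : quad (lit (a2 d) (q x)) (lit (b2 d) (q x))
     (if A1 d then q (q x) else p (p x)) (if A1 d then q (q x) else p (p x)).
    case: (boolP (A2 d)) => [e2|]; last exact: quad_litl.
    have -> : A1 d = false by apply/negbTE/negP => /eq1_neq2; rewrite e2.
    rewrite -(eqP e2).
    apply: quad_eqv (quad_sym (quad_mix (p x) (lit (a2 d) x))) _ _ _ _ => //;
      exact/eqv_sym/lit_mix.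
  by apply: quad_eqv (quad_subst H) _ _ _ _ => //; exact/eqv_sym/mix_eqv.
have H c : quad (if A1 c then q (q x) else p (p x))
                (if A1 c then q (q x) else p (p x)) M M by case: ifP.
by apply: quad_eqv (quad_subst H) _ _ _ _ => //; exact/eqv_sym/subst_const.
Qed.

Lemma dominates_mix_subst a b u (w : C -> E) : bool_equation a b ->
  (forall c, a c = b c -> dominates u (w c)) -> dominates (mix a u) (S w).
Proof.
move=> eab H; split.
  apply: (nae_mix eab) => c /H uw; exact: (dominates_lit _ _ true).
apply: nae_eqv (eqv_refl _) (eqv_refl _) (eqv_sym (bar_subst w)).
apply: (nae_mix eab) => c /H uw; exact: (dominates_lit _ _ false).
Qed.

(* [b] lies in the class of [a] off [A1] and [b'] does so off [A2].  Since [A1]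
   and [A2] are disjoint, whenever two copies of [b] are expanded one after the
   other, one of them shows an element of the class of [a] in the last step. *)
Lemma mutually_dominating_pair :
  exists u v, dominates u v /\ dominates v u.
Proof.
have [m [e me]] := dominating_pair.
pose alpha := q m; pose a := p alpha.
pose b' := S (fun c => if A2 c then e else bar a).
pose b := S (fun c => if A1 c then b' else a).
have alpha_b' : dominates alpha b'.
  by apply: (dominates_mix_subst E2) => c /eqP ->.
have a_b' : dominates a b' by exact: dominates_substl.
have a_e : dominates a e by do 2! apply: dominates_substl.
have a_b : dominates a b.
  by apply: (dominates_mix_subst E1) => c /eqP ->.
exists a, b; split=> //.
have H i : nae b b (lit i a).
  have H c : nae (if A1 c then b' else a) b (lit i a).
    case: ifP => _; last by apply/nae_swap23; exact: (dominates_lit true i true a_b).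
    (* The first two entries are [bar a, b'] on [A1], [e, a] on [A2], and [bar a, a] elsewhere. *)
    have H d : nae (if A2 d then e else bar a) (if A1 d then b' else a) (lit i a).
      case: (boolP (A1 d)) => [/eq1_neq2 ->|_].
        by apply/nae_swap23; exact: (dominates_lit false i true a_b').
      case: ifP => _; last exact/nae_swap12/nae_compl.
      by apply/nae_swap12/nae_swap23; exact: (dominates_lit true i true a_e).
    by apply: nae_eqv (nae_subst s H) _ _ _ => //; exact/eqv_sym/subst_const.
  by apply: nae_eqv (nae_subst s H) _ _ _ => //; exact/eqv_sym/subst_const.
by split; [exact: (H true)|exact: (H false)].
Qed.

(** Expanding [q a] by the second identity leaves the columns of [A2], where [V] shows [p b];
    expanding [p b] by the first leaves those of [A1], where [V] shows [q a]. The two dominations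
    settle these. *)
Lemma nae_diagonal : exists u, nae u u u.
Proof.
have [a [b [ab ba]]] := mutually_dominating_pair.
pose V := S (fun c => if A1 c then q a else p b).
have substr u v i h : dominates u v -> nae (lit i u) (lit i u) (mix h v).
  move=> uv; have H := nae_subst s (fun c => dominates_lit i i (h c) uv).
  by apply: nae_eqv H _ _ _ => //; exact/eqv_sym/subst_const.
have Ha : nae (q a) (q a) V.
  apply: (nae_mix E2) => c e2; case: ifP => [/eq1_neq2|_]; first by rewrite e2 eqxx.
  exact: substr.
have Hb : nae (p b) (p b) V.
  by apply: (nae_mix E1) => c /eqP ->; exact: substr.
have H c : nae (if A1 c then q a else p b) (if A1 c then q a else p b) V.
  by case: ifP.
by exists V; apply: nae_eqv (nae_subst s H) _ _ (eqv_sym (subst_const V s)).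
Qed.

End DoubleLoop.

(** * Triples as values of a 6-ary term *)

Definition row (b1 b2 b3 b4 b5 b6 : bool) : 'I_6 -> bool :=
  tnth [tuple b1; b2; b3; b4; b5; b6].

(* The six columns of these rows are the six nonconstant triples. *)
Definition row1 := row true false false false true true.
Definition row2 := row false true false true false true.
Definition row3 := row false false true true true false.

Lemma nae_term u v w : nae u v w ->
  exists t : term D 'I_6, forall nu : bool -> B,
    [/\ eval (nu \o row1) t = eval nu u,
        eval (nu \o row2) t = eval nu v &
        eval (nu \o row3) t = eval nu w].
Proof.
elim=> {u v w} [i j k ijk|f us vs ws _ IH|u v w u' v' w' _ [t Ht] uu' vv' ww'].
- suff [o <- [<- <-]] : exists2 o : 'I_6, row1 o = i & row2 o = j /\ row3 o = k.
    by exists (Var o).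
  by move: ijk; case: i j k => [] [] [] // _;
    [exists (inord 5)|exists (inord 4)|exists (inord 0)
    |exists (inord 3)|exists (inord 1)|exists (inord 2)];
    rewrite /row1 /row2 /row3 /row ?(tnth_nth true) /= inordK.
- have [t Ht] := choice IH; exists (App f t) => nu /=.
  by split; congr (interp _); apply/funext => i; case: (Ht i nu).
- by exists t => nu; rewrite -uu' -vv' -ww'.
Qed.

(** * Reducing the number of identities to two *)

Definition loop (n : nat) : Prop :=
  exists C (s : term D C) (rows : seq ((C -> bool) * (C -> bool))),
    [/\ size rows = n,
        List.Forall (fun r => bool_equation s r.1 r.2) rows
      & forall c, has (fun r => r.1 c != r.2 c) rows].

Lemma loop_pad n : loop n -> loop n.+1.
Proof.
move=> [C [s [rows [<- eqs cov]]]].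
exists C, s, ((xpredT, xpredT) :: rows); split=> //.
exact: List.Forall_cons.
Qed.

Section LoopStep.
Variables (C : Type) (s : term D C).
Implicit Types r : (C -> bool) * (C -> bool).

Definition cube : term D (C * C * C) :=
  subst (fun c1 => subst (fun c2 => subst (fun c3 => Var (c1, c2, c3)) s) s) s.

Lemma eval_cube (h : C * C * C -> B) : eval h cube =
  eval (fun c1 => eval (fun c2 => eval (fun c3 => h (c1, c2, c3)) s) s) s.
Proof.
rewrite /cube eval_subst; apply: eq_eval => c1.
by rewrite eval_subst; apply: eq_eval => c2; rewrite eval_subst.
Qed.

(** Two identities used in succession: the second acts only in columns that the first does not
    separate, so the sides differ exactly when one of the two separates its column. *)
Definition seql r r' c d := r.1 c == r'.1 d.
Definition seqr r r' c d :=
  r.2 c == (if r.1 c == r.2 c then r'.2 d else r'.1 d).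

Lemma seq_neq r r' c d :
  (seql r r' c d != seqr r r' c d) = (r.1 c != r.2 c) || (r'.1 d != r'.2 d).
Proof.
rewrite /seql /seqr.
by case: (r.1 c) (r.2 c) (r'.1 d) (r'.2 d) => [] [] [] [].
Qed.

Lemma seq_equation r r' (nu : bool -> B) :
    bool_equation s r.1 r.2 -> bool_equation s r'.1 r'.2 ->
  eval (fun c => eval (fun d => nu (seql r r' c d)) s) s =
  eval (fun c => eval (fun d => nu (seqr r r' c d)) s) s.
Proof.
move=> e e'; have := e (fun i => eval (fun d => nu (i == r'.1 d)) s).
rewrite /comp /seql => /= ->; apply: eq_eval => c; rewrite /seqr.
by case: (r.1 c == r.2 c) => //; exact: (e' (fun i => nu (r.2 c == i))).
Qed.

(* Regard (c1, c2, c3) as columns chosen in three successive rounds.  The left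
   half [I1] of the first row looks at rounds 1 and 2, its right half [I2] at
   rounds 2 and 3; the second row lets [r0] or [r1] act in round 2, depending on
   round 1, and [r2] in round 3. *)
Lemma loop_cube r0 r1 r2 rs :
    List.Forall (fun r => bool_equation s r.1 r.2) [:: r0, r1, r2 & rs] ->
    (forall c, has (fun r => r.1 c != r.2 c) [:: r0, r1, r2 & rs]) ->
  loop (size rs).+2.
Proof.
move=> eqs cov.
have [e0 [e1 [e2 ers]]] : bool_equation s r0.1 r0.2 /\ bool_equation s r1.1 r1.2 /\
    bool_equation s r2.1 r2.2 /\ List.Forall (fun r => bool_equation s r.1 r.2) rs.
  by do 3! [move: eqs => /List.Forall_cons_iff[? eqs]].
pose d0 c := r0.1 c != r0.2 c.
pose d1 c := r1.1 c != r1.2 c.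
pose I1 (w : C * C * C) := let: (c1, c2, c3) := w in
  d0 c1 || ~~ (d0 c2 || d1 c2).
pose I2 (w : C * C * C) := let: (c1, c2, c3) := w in
  d0 c2 || ~~ (d0 c3 || d1 c3).
pose J (sq : _ -> _ -> C -> C -> bool) (w : C * C * C) := let: (c1, c2, c3) := w in
  sq (if d0 c1 then r0 else r1) r2 c2 c3.
pose K (sq : _ -> _ -> C -> C -> bool) r (w : C * C * C) := let: (c1, c2, c3) := w in
  sq r r c2 c3.
exists (C * C * C)%type, cube,
  [:: (I1, I2), (J seql, J seqr) & [seq (K seql r, K seqr r) | r <- rs]].
split; first by rewrite /= size_map.
- apply: List.Forall_cons; [|apply: List.Forall_cons].
  + move=> nu; rewrite !eval_cube /=.
    (* [I1] ignores round 3, [I2] ignores round 1, and both are the same function of two consecutive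
       rounds; idempotence removes the ignored round. *)
    rewrite [RHS]eval_const //; apply: eq_eval => c1.
    by apply: eq_eval => c2; rewrite eval_const.
  + move=> nu; rewrite !eval_cube /=; apply: eq_eval => c1.
    by apply: seq_equation => //; case: ifP.
  + elim: rs ers {eqs cov} => [|r rs IH] /=; first by constructor.
    move=> /List.Forall_cons_iff[er /IH ers]; apply: List.Forall_cons => // nu.
    by rewrite !eval_cube /=; apply: eq_eval => c1; exact: seq_equation.
- move=> [[c1 c2] c3] /=.
  have := cov c2; have := cov c3; rewrite /= seq_neq has_map.
  set k := has (preim _ _) rs.
  have -> : k = has (fun r => r.1 c2 != r.2 c2) rs ||
                has (fun r => r.1 c3 != r.2 c3) rs.
    by rewrite -has_predU; apply: eq_has => r /=; rewrite seq_neq.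
  case: (has _ rs); case: (has _ rs); rewrite /= ?orbT // /d0 /d1.
  rewrite !orbF.
  case: (r2.1 c3 != _); rewrite /= ?orbT //= !orbF.
  (* Now [r0] or [r1] separates [c3], so [I2] is [d0 c2]. If the second row fails, then [d0 c1]
     holds without [d0 c2], or neither [d0 c1] nor [d1 c2] holds; both make [I1] the negation of
     [d0 c2]. *)
  case: (r0.1 c1 != _); case: (r0.1 c2 != _); case: (r1.1 c2 != _);
  case: (r0.1 c3 != _); case: (r1.1 c3 != _) => //=.
Qed.

End LoopStep.

Lemma loop_two n : loop n -> loop 2.
Proof.
elim: n => [|n IH]; first by do 2! move/loop_pad.
case: n => [|[|n]] in IH *; [exact: loop_pad|by []|].
move=> [C [s [rows [sz eqs cov]]]]; apply: IH.
case: rows sz eqs cov => [|r0 [|r1 [|r2 rs]]] //= [<-] eqs cov.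
exact: loop_cube eqs cov.
Qed.

Lemma loop_nae_diagonal n : loop n -> exists u, nae u u u.
Proof.
move=> /loop_two[C [s [rows [sz eqs cov]]]].
case: rows sz eqs cov => [|[a1 b1] [|[a2 b2] []]] //= _.
move=> /List.Forall_cons_iff[e1 /List.Forall_cons_iff[e2 _]] cov.
by apply: (nae_diagonal e1 e2) => c; have := cov c; rewrite orbF.
Qed.

(** * Collecting finitely many identities *)

Definition separates (C : Type) (s : term D C) (P : C -> Prop) : Prop :=
  exists2 rows, List.Forall (fun r => bool_equation s r.1 r.2) rows &
    forall c, P c -> has (fun r => r.1 c != r.2 c) rows.

Lemma separates_sub (C : Type) (s : term D C) (P Q : C -> Prop) :
  (forall c, P c -> Q c) -> separates s Q -> separates s P.
Proof. by move=> PQ [rows eqs cov]; exists rows => // c /PQ; exact: cov. Qed.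

Lemma separates_neq (C : Type) (s : term D C) (a b : C -> bool) :
  bool_equation s a b -> separates s (fun c => a c != b c).
Proof.
move=> eab; exists [:: (a, b)] => [|c /= ->//].
exact: List.Forall_cons.
Qed.

Lemma separates_or (C : Type) (s : term D C) (P Q : C -> Prop) :
  separates s P -> separates s Q -> separates s (fun c => P c \/ Q c).
Proof.
move=> [rows eqs cov] [rows' eqs' cov']; exists (rows ++ rows').
  exact/List.Forall_app.
by move=> c; rewrite has_cat => -[/cov ->|/cov' ->]; rewrite ?orbT.
Qed.

Lemma separates_list (C X : Type) (s : term D C) (P : X -> C -> Prop)
    (l : list X) :
  (forall x, List.In x l -> separates s (P x)) ->
  separates s (fun c => exists x, List.In x l /\ P x c).
Proof.
elim: l => [_|x l IH H]; first by exists [::] => // c [? []].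
apply: separates_sub (separates_or (H x (or_introl erefl)) (IH _)) => [c|y ly].
  by move=> [y [[<-|ly] Py]]; [left|right; exists y].
by apply: H; right.
Qed.

Lemma separates_nat (C : Type) (s : term D C) (P : nat -> C -> Prop) n :
  (forall i, i < n -> separates s (P i)) ->
  separates s (fun c => exists2 i, i < n & P i c).
Proof.
elim: n => [_|n IH H]; first by exists [::] => // c [].
apply: separates_sub (separates_or (H n _) (IH _)) => // [c [i]|i lin].
  by rewrite ltnS leq_eqVlt => /orP[/eqP ->|lin] Pi; [left|right; exists i].
by apply: H; rewrite ltnS ltnW.
Qed.

Lemma separates_loop (C : Type) (s : term D C) :
  separates s xpredT -> exists n, loop n.
Proof.
move=> [rows eqs cov]; exists (size rows), C, s, rows; split=> // c.
exact: cov.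
Qed.

End BinaryTerms.

(** * Terms under projections *)

Definition choices (D : signature) := forall f : symbol D, 'I_(arity f).

Fixpoint proj (D : signature) (X : Type) (pi : choices D) (t : term D X) : X :=
  match t with
  | Var x => x
  | App f args => proj pi (args (pi f))
  end.

(** Unlike in [proj], each layer of the term has its own choice function. *)
Fixpoint run (D : signature) (X : Type) (w : nat -> choices D) (t : term D X) : X :=
  match t with
  | Var x => x
  | App f args => run (fun k => w k.+1) (args (w 0 f))
  end.

(* [t] has height at most [n] and all its symbols are in [fs]. *)
Fixpoint covers (D : signature) (X : Type) (fs : list (symbol D)) (t : term D X)
    (n : nat) : Prop :=
  match t, n with
  | Var x, _ => True
  | App f args, n'.+1 => List.In f fs /\ forall i, covers fs (args i) n'
  | App f args, 0 => False
  end.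

Lemma covers_mono (D : signature) (X : Type) (fs fs' : list (symbol D))
    (t : term D X) n n' :
  List.incl fs fs' -> n <= n' -> covers fs t n -> covers fs' t n'.
Proof.
move=> sub; elim: t n n' => //= f args IH [|n] [|n'] //= nn' [ffs H].
by split=> [|i]; [exact: sub|exact: IH (H i)].
Qed.

Lemma common_bound (X Y : Type) (P : Y -> list X -> nat -> Prop) (l : list Y) :
    (forall y fs fs' n n', List.incl fs fs' -> n <= n' -> P y fs n -> P y fs' n') ->
    (forall y, List.In y l -> exists fs n, P y fs n) ->
  exists fs n, forall y, List.In y l -> P y fs n.
Proof.
move=> mono; elim: l => [_|y l IH H]; first by exists [::], 0.
have [fs [n Hy]] := H y (or_introl erefl).
have [|fs' [n' Hl]] := IH; first by move=> z lz; apply: H; right.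
exists (List.app fs fs'), (maxn n n') => z [<-|lz].
  apply: mono Hy; last exact: leq_maxl.
  by move=> x; rewrite List.in_app_iff; left.
apply: mono (Hl _ lz); last exact: leq_maxr.
by move=> x; rewrite List.in_app_iff; right.
Qed.

Lemma mem_In (X : eqType) (x : X) (l : seq X) : x \in l -> List.In x l.
Proof.
by elim: l => //= y l IH; rewrite inE => /orP[/eqP ->|/IH]; [left|right].
Qed.

Lemma covers_exists (D : signature) (X : Type) (t : term D X) :
  exists fs n, covers fs t n.
Proof.
elim: t => [x|f args IH]; first by exists [::], 0.
have [|i _|fs [n H]] := @common_bound (symbol D) _
  (fun i fs n => covers fs (args i) n) (enum 'I_(arity f)).
- by move=> i fs fs' n n'; exact: covers_mono.
- exact: IH.
exists (f :: fs), n.+1; split=> [|i]; first by left.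
apply: covers_mono (H i _); [by move=> g; right|by []|].
by apply: mem_In; rewrite mem_enum.
Qed.

Lemma run_proj (D : signature) (X : Type) (t : term D X) fs n
    (w : nat -> choices D) (pi : choices D) : covers fs t n ->
    (forall l f, l < n -> List.In f fs -> w l f = pi f) ->
  run w t = proj pi t.
Proof.
elim: t n w => //= f args IH [//|n] w [ffs H] wpi.
by rewrite wpi //; apply: IH (H _) _ => l g ln; exact: wpi.
Qed.

(** Arities are finite, so finitely many tests [run w t == v] determine the value. *)
Lemma run_bound (D : signature) (t : term D nat) :
  exists N, forall w : nat -> choices D, run w t < N.
Proof.
elim: t => [x|f args /choice[N HN]]; first by exists x.+1.
exists (\max_i N i) => w /=.
exact: leq_trans (HN (w 0 f) _) (leq_bigmax (w 0 f)).
Qed.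

(** * Star product and its self-composition *)

Section Expansion.
Variables (D : signature) (B : algebra D).
Hypothesis idemB : idempotent B.
Variable pi0 : choices D.

Definition update (pi : choices D) (f : symbol D) (i : 'I_(arity f)) : choices D :=
  fun g => match pselect (f = g) with
           | left e => ecast g 'I_(arity g) e i
           | right _ => pi g
           end.

Lemma update_same pi f (i : 'I_(arity f)) : update pi i f = i.
Proof.
rewrite /update; case: pselect => // e.
by rewrite (Prop_irrelevance e erefl).
Qed.

Lemma update_other pi f g (i : 'I_(arity f)) : f <> g -> update pi i g = pi g.
Proof. by rewrite /update; case: pselect. Qed.

(** The star product of the symbols in [fs]: a column records the branch taken at each symbol, the
    last one if a symbol is repeated. *)
Fixpoint expand (fs : list (symbol D)) (pi : choices D) : term D (choices D) :=
  match fs with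
  | nil => Var pi
  | cons f fs' => App f (fun i => expand fs' (update pi i))
  end.

Lemma eval_expand_notin fs pi f (h : 'I_(arity f) -> B) : ~ List.In f fs ->
  eval (fun pi' => h (pi' f)) (expand fs pi) = h (pi f).
Proof.
elim: fs pi => //= g fs IH pi /not_orP[gf nf].
rewrite -[RHS](idemB g); congr (interp _); apply/funext => i.
by rewrite IH // update_other.
Qed.

Lemma eval_expand fs pi f (h : 'I_(arity f) -> B) : List.In f fs ->
  eval (fun pi' => h (pi' f)) (expand fs pi) = interp h.
Proof.
elim: fs pi => //= g fs IH pi gfs.
have [ffs|nf] := pselect (List.In f fs).
  rewrite -[RHS](idemB g); congr (interp _); apply/funext => i.
  exact: IH.
case: gfs => // gf; subst g.
congr (interp _); apply/funext => i.
by rewrite eval_expand_notin // update_same.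
Qed.

Variable fs : list (symbol D).
Local Notation T := (expand fs pi0).

(* [words n] is the [n]-fold self-composition of [T]: its variables are streams
   of choice functions, only the first [n] entries of which matter. *)
Definition scons (c : choices D) (w : nat -> choices D) (k : nat) : choices D :=
  if k is k'.+1 then w k' else c.

Fixpoint words (n : nat) : term D (nat -> choices D) :=
  if n is n'.+1 then
    subst (fun c => subst (fun w => Var (scons c w)) (words n')) T
  else Var (fun=> pi0).

Lemma eval_words n (h : (nat -> choices D) -> B) :
  eval h (words n.+1) = eval (fun c => eval (fun w => h (scons c w)) (words n)) T.
Proof. by rewrite /= eval_subst; apply: eq_eval => c; rewrite eval_subst. Qed.

(** A layer is read only at the head symbol of the current subterm, so it evaluates as that symbol;
    spare layers collapse by idempotence. *)
Lemma eval_words_run (X : Type) (t : term D X) n (nu : X -> B) :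
  covers fs t n -> eval (fun w => nu (run w t)) (words n) = eval nu t.
Proof.
elim: t n => [x|f args IH] n; first by rewrite /= eval_const.
case: n => //= n [ffs H]; rewrite eval_subst.
rewrite -(eval_expand pi0 (fun i => eval nu (args i)) ffs).
by apply: eq_eval => c; rewrite eval_subst; exact: IH.
Qed.

Lemma eval_words_nth n l (h : choices D -> B) : l < n ->
  eval (fun w => h (w l)) (words n) = eval h T.
Proof.
elim: n l => // n IH [|l] ln; rewrite eval_words.
  by apply: eq_eval => c /=; rewrite eval_const.
rewrite -[RHS](@eval_const _ B _ _ T) //.
by apply: eq_eval => c; exact: IH.
Qed.

End Expansion.

(** * Identities from failure in projections *)

(** The identities compare the two [run] values of an equation, or layer [l] with layer 0. A column
    missed by the layer tests is constant on [fs], so its [run] is a projection, and some equation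
    of [L] separates it. *)
Lemma loop_of_unsatisfiable (D : signature) (B : algebra D)
    (L : list (equation D)) :
    idempotent B -> inhabited (choices D) ->
    (forall pi, exists e,
      [/\ List.In e L, satisfies_eq B e & proj pi e.1 <> proj pi e.2]) ->
  exists n, loop B n.
Proof.
move=> idemB [pi0] unsat.
have [|e _|fs [n H]] := @common_bound (symbol D) _
    (fun e fs n => covers fs e.1 n /\ covers fs e.2 n) L.
- move=> e fs fs' n n' sub nn' [H1 H2].
  by split; [exact: covers_mono H1|exact: covers_mono H2].
- have [fs1 [n1 H1]] := covers_exists e.1.
  have [fs2 [n2 H2]] := covers_exists e.2.
  exists (List.app fs1 fs2), (maxn n1 n2); split.
    by apply: covers_mono H1; [exact: List.incl_appl|exact: leq_maxl].
  by apply: covers_mono H2; [exact: List.incl_appr|exact: leq_maxr].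
(* The successor ensures that layer 0 exists. *)
pose s := words pi0 fs n.+1.
have {}H e : List.In e L -> covers fs e.1 n.+1 /\ covers fs e.2 n.+1.
  by move=> /H[H1 H2]; split; [exact: covers_mono H1|exact: covers_mono H2].
have sepR : separates B s (fun w => exists e, List.In e L /\
    (satisfies_eq B e /\ run w e.1 <> run w e.2)).
  apply: separates_list => e Le; have [H1 H2] := H e Le.
  have [satE|nsat] := pselect (satisfies_eq B e); last by exists nil => // w [].
  have [N HN] := run_bound e.1.
  have sepV : separates B s (fun w =>
      exists2 v, v < N & (run w e.1 == v) != (run w e.2 == v)).
    apply: separates_nat => v _; apply: separates_neq => nu.
    rewrite (eval_words_run idemB _ (fun i => nu (i == v)) H1).
    rewrite (eval_words_run idemB _ (fun i => nu (i == v)) H2).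
    exact: satE.
  apply: separates_sub sepV => w [_ neq]; exists (run w e.1) => //.
  by rewrite eqxx eq_sym; apply/eqP => /eqP e12; apply: neq.
have sepC : separates B s (fun w => exists f, List.In f fs /\
    exists2 l, l < n.+1 & exists2 i, i < arity f &
      (w 0 f == i :> nat) != (w l f == i :> nat)).
  apply: separates_list => f ffs; apply: separates_nat => l ln.
  apply: separates_nat => i _; apply: separates_neq => nu /=.
  rewrite (@eval_words_nth _ _ idemB _ _ _ 0 (fun c => nu (c f == i :> nat))) //.
  by rewrite (@eval_words_nth _ _ idemB _ _ _ l (fun c => nu (c f == i :> nat))).
apply: (separates_loop (s := s)).
apply: separates_sub (separates_or sepR sepC) => w _.
have [cst|/existsNP[l /existsNP[f /not_implyP[ln /not_implyP[ffs neq]]]]] :=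
    pselect (forall l f, l < n.+1 -> List.In f fs -> w l f = w 0 f).
  left; have [e [Le satE neq]] := unsat (w 0); have [H1 H2] := H e Le.
  by exists e; rewrite (run_proj H1 cst) (run_proj H2 cst).
right; exists f; split=> //; exists l => //; exists (w l f) => //.
rewrite eqxx eqb_id; apply/eqP => e; apply: neq; exact/val_inj.
Qed.

(** * Compactness *)

(** Arities being finite, the choices [p L f] have a limit along an ultrafilter of finite lists;
    [proj] reads finitely many symbols of a term, so it commutes with the limit. *)
Lemma projection_compactness (D : signature) (P : equation D -> Prop) :
    (forall L : list (equation D), exists pi : choices D,
      forall e, List.In e L -> P e -> proj pi e.1 = proj pi e.2) ->
  exists pi : choices D, forall e, P e -> proj pi e.1 = proj pi e.2.
Proof.
move=> /choice[p Hp].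
pose up (L0 : list (equation D)) : set (list (equation D)) := List.incl L0.
have up_filter : ProperFilter (filter_from setT up).
  apply: filter_from_proper => [|L0 _]; last by exists L0.
  apply: filter_fromT_filter => [|L1 L2]; first by exists nil.
  exists (List.app L1 L2) => L sub; split=> e Le; apply: sub;
    apply/List.in_app_iff; by [left|right].
have [U [UU sub]] := ultraFilterLemma up_filter.
have ex (f : symbol D) : exists i, U (fun L => p L f = i).
  apply: contrapT => /forallNP none.
  have : U (fun L => forall i, p L f <> i).
    apply: filter_forall => i.
    by have [/none|] := in_ultra_setVsetC (fun L => p L f = i) UU.
  by move=> /filter_ex[L /(_ (p L f))].
pose pi f := projT1 (cid (ex f)).
have Hpi f : U (fun L => p L f = pi f) by exact: projT2 (cid (ex f)).
have agree (t : term D nat) : U (fun L => proj (p L) t = proj pi t).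
  elim: t => [x|f args IH]; first by apply: filterS filterT.
  by apply: filterS (filterI (Hpi f) (IH (pi f))) => L [/= ->].
exists pi => e Pe.
have /sub Ue : filter_from setT up (up [:: e]) by exists [:: e].
have [L [[e1 e2] eL]] := filter_ex (filterI (filterI (agree e.1) (agree e.2)) Ue).
by rewrite -e1 -e2; apply: Hp => //; apply: eL; left.
Qed.

(** * Translating a condition into the algebra *)

Lemma eval_plug (Sigma : signature) (A : algebra Sigma) (n : nat) (X : Type)
    (v : X -> A) (t : term Sigma 'I_n) (u : n.-tuple (term Sigma X)) :
  eval v (plug t u) = eval (fun i => eval v (tnth u i)) t.
Proof. exact: eval_subst. Qed.

Lemma eval_translate (Delta Sigma : signature) (A : algebra Sigma)
    (tau : forall f : symbol Delta, term Sigma 'I_(arity f)) (X : Type)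
    (v : X -> A) (t : term Delta X) :
  eval v (translate tau t) =
  eval (A := @Algebra Delta A (fun f a => eval a (tau f))) v t.
Proof.
by elim: t => //= f args IH; rewrite eval_subst; exact: eq_eval.
Qed.

Lemma translate_choices (Delta Sigma : signature) (pi : choices Delta) (X : Type)
    (t : term Delta X) :
  translate (fun f => @Var Sigma _ (pi f)) t = Var (proj pi t).
Proof. by elim: t => //= f args ->. Qed.

(** Otherwise compactness yields projections satisfying all equations, and variables realize them in
    every algebra. *)
Lemma nontrivial_unsatisfiable (S : eq_condition) : ~ trivial_cond S ->
  exists L : list (equation (cond_sig S)), forall pi : choices (cond_sig S),
    exists e, [/\ List.In e L, cond_eqs e & proj pi e.1 <> proj pi e.2].
Proof.
apply: contra_notP => /forallNP noL.
have [L|pi Hpi] := @projection_compactness _ (@cond_eqs S).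
  have /existsNP[pi Hpi] := noL L; exists pi => e eL Pe.
  by apply: contrapT => neq; apply: Hpi; exists e.
move=> Sigma A; exists (fun f => Var (pi f)) => l r lr v.
by rewrite !translate_choices (Hpi _ lr).
Qed.

(** An idempotent constant equals every element, which gives the first alternative; if no symbol is
    nullary, choice functions exist. *)
Lemma translated_nae (S : eq_condition) (Sigma : signature) (A : algebra Sigma)
    (tau : forall f : symbol (cond_sig S), term Sigma 'I_(arity f)) :
    ~ trivial_cond S -> idempotent_cond S ->
    (forall s t, cond_eqs (s, t) ->
      satisfies_eq A (translate tau s, translate tau t)) ->
  (forall a b : A, a = b) \/
  let B := @Algebra (cond_sig S) A (fun f a => eval a (tau f)) in
  idempotent B /\ exists u, nae B u u u.
Proof.
move=> ntS idS sat; set B := Algebra _.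
have satB e : cond_eqs e -> satisfies_eq B e.
  by case: e => s t st v /=; have := sat s t st v; rewrite /= !eval_translate.
have idemB : idempotent B by move=> f b; exact: (idS f B satB (fun=> b)).
have [[f f0]|/forallNP ar] := pselect (exists f : symbol (cond_sig S), arity f = 0).
  left=> a b; rewrite -(idemB f a) -(idemB f b).
  by congr (@interp _ B f _); apply/funext => i; exfalso; case: i => k; rewrite f0.
right; split=> //; have [L HL] := nontrivial_unsatisfiable ntS.
have [||n] := @loop_of_unsatisfiable _ B L idemB.
- constructor=> f; have := ar f; case: (arity f) => // n _; exact: ord0.
- move=> pi; have [e [eL Pe neq]] := HL pi; exists e; split=> //; exact: satB.
- exact: loop_nae_diagonal.
Qed.

Lemma eval_plug_var (Sigma : signature) (A : algebra Sigma) (X : Type)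
    (v : X -> A) (t : term Sigma 'I_6) x1 x2 x3 x4 x5 x6 :
  eval v (plug t [tuple Var x1; Var x2; Var x3; Var x4; Var x5; Var x6]) =
  eval (fun i => v (tnth [tuple x1; x2; x3; x4; x5; x6] i)) t.
Proof.
rewrite eval_plug; apply: eq_eval => i; rewrite !(tnth_nth x1, tnth_nth (Var x1)).
by case: i => [[|[|[|[|[|[|]]]]]]].
Qed.

(** * The 6-ary condition and the equivalence *)

Definition six_ary_signature := @Signature unit (fun=> 6).

Definition op (u : 6.-tuple (term six_ary_signature nat)) :
  term six_ary_signature nat := @App six_ary_signature nat tt (tnth u).

Lemma translate_op (Sigma : signature)
    (tau : forall f : symbol six_ary_signature, term Sigma 'I_(arity f))
    x1 x2 x3 x4 x5 x6 :
  translate tau (op [tuple Var x1; Var x2; Var x3; Var x4; Var x5; Var x6]) =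
  plug (tau tt) [tuple Var x1; Var x2; Var x3; Var x4; Var x5; Var x6].
Proof.
congr (subst _ _); apply/funext => i; rewrite !(tnth_nth (Var x1)).
by case: i => [[|[|[|[|[|[|]]]]]]].
Qed.

Definition six_ary_condition : eq_condition :=
  let x := Var 0 in
  let y := Var 1 in
  @EqCondition six_ary_signature (fun e =>
    [\/ e = (op [tuple of nseq 6 x], x),
        e = (op [tuple x; y; y; y; x; x], op [tuple y; x; y; x; y; x])
      | e = (op [tuple y; x; y; x; y; x], op [tuple y; y; x; x; x; y])]).

(** Over the empty signature [tau tt] is a variable, but with x true and y false no column of the
    equations is constant. *)
Lemma six_ary_condition_nontrivial : ~ trivial_cond six_ary_condition.
Proof.
pose S0 := @Signature void (fun=> 0).
pose A0 := @Algebra S0 bool (fun f _ => true).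
move=> /(_ S0 A0)[tau sat].
have := sat _ _ (Or32 _ _ erefl) (fun n => n == 0).
have := sat _ _ (Or33 _ _ erefl) (fun n => n == 0).
rewrite /= !eval_subst; case: (tau tt) => [i|[]] /=.
rewrite !(tnth_nth (Var 0)).
by case: i => [[|[|[|[|[|[|]]]]]]].
Qed.

Theorem theorem1p1 (Sigma : signature) (A : algebra Sigma) :
  (exists S : eq_condition,
     [/\ ~ trivial_cond S, idempotent_cond S & satisfies_cond A S])
  <->
  (exists t : term Sigma 'I_6,
     let x := Var 0 in
     let y := Var 1 in
     [/\ idempotent_term A t,
         satisfies_eq A (plug t [tuple x; y; y; y; x; x],
                         plug t [tuple y; x; y; x; y; x])
       & satisfies_eq A (plug t [tuple y; x; y; x; y; x],
                         plug t [tuple y; y; x; x; x; y])]).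

Proof.
split=> [[S [ntS idS [tau sat]]]|[t [idt eq1 eq2]]].
- have [sub|[idemB [u uuu]]] := translated_nae ntS idS sat.
    by exists (Var ord0); split=> v; exact: sub.
  have [t Ht] := nae_term uuu; pose T := translate tau t.
  have HT (nu : bool -> A) : eval (nu \o row1) T = eval (nu \o row2) T /\
                             eval (nu \o row2) T = eval (nu \o row3) T.
    by rewrite !eval_translate; have [-> -> ->] := Ht nu.
  have idemT (b : A) : eval (fun=> b) T = b.
    by rewrite eval_translate; exact: (eval_const _ t idemB).
  (* [true] stands for x, which is variable 0; hence the negation. *)
  pose nu (v : nat -> A) (b : bool) := v (nat_of_bool (~~ b)).
  have E1 v : eval (fun i => v (tnth [tuple 0; 1; 1; 1; 0; 0] i)) T =
      eval (nu v \o row1) T.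
    apply: eq_eval => -[i lti]; rewrite /= (tnth_nth 0) /row1 /row (tnth_nth true).
    by case: i lti => [|[|[|[|[|[|]]]]]].
  have E2 v : eval (fun i => v (tnth [tuple 1; 0; 1; 0; 1; 0] i)) T =
      eval (nu v \o row2) T.
    apply: eq_eval => -[i lti]; rewrite /= (tnth_nth 0) /row2 /row (tnth_nth true).
    by case: i lti => [|[|[|[|[|[|]]]]]].
  have E3 v : eval (fun i => v (tnth [tuple 1; 1; 0; 0; 0; 1] i)) T =
      eval (nu v \o row3) T.
    apply: eq_eval => -[i lti]; rewrite /= (tnth_nth 0) /row3 /row (tnth_nth true).
    by case: i lti => [|[|[|[|[|[|]]]]]].
  exists T; split=> v.
  + rewrite /= eval_plug -[RHS]idemT.
    by apply: eq_eval => i; rewrite tnth_nseq.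
  + by rewrite /= !eval_plug_var E1 E2; case: (HT (nu v)).
  + by rewrite /= !eval_plug_var E2 E3; case: (HT (nu v)).
- exists six_ary_condition; split; first exact: six_ary_condition_nontrivial.
    move=> [] C /(_ _ (Or31 _ _ erefl)) idC v; rewrite -[RHS]idC /=.
    by congr (interp _); apply/funext => i; rewrite tnth_nseq.
  exists (fun=> t) => l r [[-> ->]|[-> ->]|[-> ->]]; rewrite ?translate_op //.
  move=> v; rewrite -[RHS]idt /= eval_subst eval_plug.
  by apply: eq_eval => i; rewrite !tnth_nseq.
Qed.
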